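(* Let $\lambda=(\lambda_k)_{k\ge 0}$ be a strictly increasing sequence of positive real numbers tending to $\infty$, with $\lambda_{-1}=0$, and let $p=(p_k)_{k\ge 0}$ be a bounded sequence of strictly positive real numbers. Then the inclusion $\ell(\lambda,p)\subset c_0(\lambda,p)$ holds and is strict.
   Context: For a real sequence $x=(x_k)_{k\ge0}$ put $\Lambda_n(x)=\frac{1}{\lambda_n}\sum_{k=0}^{n}(\lambda_k-\lambda_{k-1})x_k$. Define $\ell(\lambda,p)=\{x\in\mathbb{R}^{\mathbb{N}}:\sum_{n=0}^\infty|\Lambda_n(x)|^{p_n}<\infty\}$ and $c_0(\lambda,p)=\{x\in\mathbb{R}^{\mathbb{N}}:\lim_{n\to\infty}|\Lambda_n(x)|^{p_n}=0\}$. *)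

(* Defs.v *)
From mathcomp Require Import all_boot all_order all_algebra.
From mathcomp Require Import all_classical all_reals all_analysis.

Set Implicit Arguments.
Unset Strict Implicit.
Unset Printing Implicit Defensive.

Import Order.TTheory GRing.Theory Num.Theory.
Import numFieldNormedType.Exports.

Local Open Scope classical_set_scope.
Local Open Scope ring_scope.

(* [lam_pred lam k] is lambda_(k-1), with the convention lambda_(-1) = 0. *)
Definition lam_pred (R : realType) (lam : R^nat) (k : nat) : R :=
  if k is k'.+1 then lam k' else 0.

Definition Lam (R : realType) (lam x : R^nat) (n : nat) : R :=
  (lam n)^-1 * \sum_(0 <= k < n.+1) (lam k - lam_pred lam k) * x k.

(* The extended-real sum of a series of nonnegative terms always exists, so
   [< +oo] means that the series converges.  For 0 < a, 0 `^ a = 0. *)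
Definition ell (R : realType) (lam p : R^nat) : set R^nat :=
  [set x | (\sum_(0 <= n <oo) (`|Lam lam x n| `^ p n)%:E < +oo)%E].

Definition c0 (R : realType) (lam p : R^nat) : set R^nat :=
  [set x | (`|Lam lam x n| `^ p n) @[n --> \oo] --> (0 : R)].

(* Main.v *)
Require Import Defs.
From mathcomp Require Import all_boot all_order all_algebra.
From mathcomp Require Import all_classical all_reals all_analysis.
Import Order.TTheory GRing.Theory Num.Theory.
Import numFieldNormedType.Exports.

Local Open Scope classical_set_scope.
Local Open Scope ring_scope.

(** The terms of a convergent series tend to 0, which gives the inclusion. For
    strictness, [Lam lam] is onto because it is triangular with nonzero diagonal;
    a preimage of [n |-> (n + 1)^(-1 / p n)] yields the harmonic series, which
    diverges although its terms tend to 0. *)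

(** Solves [lam k * y k - lam_pred lam k * y k.-1 = (lam k - lam_pred lam k) * x k] for [x k], the
    difference of consecutive weighted sums. At [k = 0] the junk value [0.-1 = 0] is harmless, as
    [lam_pred lam 0 = 0]. *)
Definition Lam_inv {R : realType} (lam y : R^nat) (k : nat) : R :=
  (lam k * y k - lam_pred lam k * y k.-1) / (lam k - lam_pred lam k).

Lemma lam_pred_lt (R : realType) (lam : R^nat) (k : nat) :
  (forall k, 0 < lam k) -> increasing_seq lam -> lam_pred lam k < lam k.
Proof.
move=> lam_pos lam_incr; case: k => [|k] /=; first exact: lam_pos.
(* [increasing_seq] is an equivalence of the two orders, hence strict. *)
by rewrite ltNge lam_incr ltnn.
Qed.

Lemma Lam_invK (R : realType) (lam y : R^nat) :
  (forall k, 0 < lam k) -> increasing_seq lam -> Lam lam (Lam_inv lam y) = y.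
Proof.
move=> lam_pos lam_incr; apply/funext => n.
have termE k : (lam k - lam_pred lam k) * Lam_inv lam y k =
    lam k * y k - lam_pred lam k * y k.-1.
  by rewrite mulrC divfK// subr_eq0 gt_eqF// lam_pred_lt.
(* By [termE] the sum telescopes. *)
suff sumE : \sum_(0 <= k < n.+1) (lam k - lam_pred lam k) * Lam_inv lam y k
    = lam n * y n.
  by rewrite /Lam sumE mulKf// gt_eqF.
elim: n => [|n IHn]; first by rewrite big_nat1 termE /= mul0r subr0.
by rewrite big_nat_recr//= IHn termE addrC subrK.
Qed.

Theorem theorem3 (R : realType) (lam p : R^nat)
    (lam_pos : forall k, 0 < lam k)
    (lam_incr : increasing_seq lam)
    (lam_oo : lam n @[n --> \oo] --> +oo)
    (p_pos : forall k, 0 < p k)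
    (p_bnd : bounded_fun p) :
  ell lam p `<` c0 lam p.
Proof.
have ell_cvg x : ell lam p x ->
    cvgn (series (fun n => `|Lam lam x n| `^ p n)).
  by move=> ellx; apply: nnseries_is_cvg => // n; exact: powR_ge0.
(* Strictness means that the reverse inclusion [c0_ell] is absurd. *)
split=> [x /ell_cvg|c0_ell]; first exact: cvg_series_cvg_0.
pose x := Lam_inv lam (fun n => n.+1%:R^-1 `^ (p n)^-1).
have xE : (fun n => `|Lam lam x n| `^ p n) = harmonic.
  apply/funext => n; rewrite /x Lam_invK// ger0_norm ?powR_ge0//.
  by rewrite -powRrM mulVf ?gt_eqF// powRr1// invr_ge0.
have : c0 lam p x by rewrite /c0 /= xE; exact: cvg_harmonic.
by move=> /c0_ell/ell_cvg; rewrite xE; exact: dvg_harmonic.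
Qed.
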